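(* Let $X$ be a finite set and let $\varnothing\neq Z\subseteq Y\subseteq X$ with $|X|=n$, $|Y|=m$ and $|Z|=k$. Then $$|\mathcal{T}(X,Y,Z)|=\sum_{r=1}^{k}\binom{k}{r}\,r!\,S(m,r)\,n^{n-m}=k^m n^{n-m}.$$
   Context: $\mathcal{T}(X)$ is the set of all maps $X\to X$; maps are written on the right and $A\alpha=\{a\alpha : a\in A\}$ for $A\subseteq X$. For $\varnothing\neq Z\subseteq Y\subseteq X$, $\mathcal{T}(X,Y,Z)=\{\alpha\in\mathcal{T}(X): Y\alpha\subseteq Z\}$. $S(p,r)$ is the Stirling number of the second kind, the number of partitions of a $p$-element set into $r$ nonempty (indistinguishable) blocks. *)

(* Defs.v *)
From mathcomp Require Import all_boot.

Set Implicit Arguments.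
Unset Strict Implicit.
Unset Printing Implicit Defensive.

(* Transformations of X are finite functions, so that sets of them can be
   counted; the image Y alpha (maps written on the right) is alpha @: Y. *)
Definition transf (X : finType) (Y Z : {set X}) : {set {ffun X -> X}} :=
  [set alpha : {ffun X -> X} | alpha @: Y \subset Z].

(* Stirling number of the second kind; [partition] already requires the blocks
   to be nonempty. *)
Definition stirling2 (p r : nat) : nat :=
  #|[set P : {set {set 'I_p}} | partition P [set: 'I_p] & #|P| == r]|.

(* Main.v *)
Require Import Defs.
From mathcomp Require Import all_boot.

(** A map in T(X,Y,Z) is an arbitrary map from Y to Z together with an arbitrary
map from the complement of Y to X, whence k^m n^(n-m). The sum counts the k^m
maps from an m-set to a k-set according to their kernel partition: the maps with
kernel P correspond to the injections of the set of blocks of P into the k-set,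
so there are k (k-1) ... (k-r+1) = 'C(k, r) r! of them when P has r blocks. *)

Lemma card_transf (X : finType) (Y Z : {set X}) :
  #|transf Y Z| = #|Z| ^ #|Y| * #|X| ^ (#|X| - #|Y|).
Proof.
(* [F x] holds the values allowed at [x], so the count is a product over the points, split below
   into [Y] and its complement. *)
pose F x := if x \in Y then mem Z else mem X.
have -> : #|transf Y Z| = #|family F|.
  apply: eq_card => f; rewrite inE.
  apply/subsetP/familyP => [fYZ x | fF _ /imsetP[x Yx ->]].
    by rewrite /F; case: ifP => // Yx; apply/fYZ/imset_f.
  by have := fF x; rewrite /F Yx.
rewrite card_family foldrE big_map big_enum /= (bigID (mem Y)) /=.
congr (_ * _).
  rewrite -(prod_nat_const (mem Y)); apply: eq_bigr => x Yx.
  by rewrite /F Yx; apply: eq_card.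
rewrite -cardsT -cardsDS ?subsetT // setTD cardsT -prod_nat_const.
apply: eq_big => [x|x /negPf Yx]; first by rewrite inE.
by rewrite /F Yx; apply: eq_card.
Qed.

Lemma pblock_preim_partition (T R : finType) (f : T -> R) (x y : T) :
  (y \in pblock (preim_partition f [set: T]) x) = (f x == f y).
Proof.
rewrite pblock_equivalence_partition ?in_setT // => a b c _ _ _.
by split=> // /eqP ->.
Qed.

(** A map with kernel [P] factors uniquely through the map sending a point to its block, and the
    induced map on blocks is injective; conversely, each such injection yields a map with kernel
    [P]. *)
Lemma card_preim_partition_fiber (T R : finType) (P : {set {set T}}) :
  partition P [set: T] ->
  #|[set f : {ffun T -> R} | preim_partition f [set: T] == P]| = #|R| ^_ #|P|.
Proof.
move=> partP; have /and3P[/eqP covP trivP P0] := partP.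
pose D := {B : {set T} | B \in P}.
have blockP x : pblock P x \in P by rewrite pblock_mem // covP inE.
pose blk x : D := Sub (pblock P x) (blockP x).
have blk_surj (B : D) : exists x, blk x == B.
  case: B => B PB; have /set0Pn[x Bx] : B != set0 by apply: contraNneq P0 => <-.
  by exists x; rewrite -val_eqE /= (def_pblock trivP PB).
have -> : #|P| = #|{: D}| by rewrite card_sig; apply: eq_card.
rewrite -card_inj_ffuns.
pose h (g : {ffun D -> R}) := [ffun x => g (blk x)].
have h_inj : injective h.
  move=> g1 g2 /ffunP eq_h; apply/ffunP => B.
  by have [x /eqP <-] := blk_surj B; have := eq_h x; rewrite !ffunE.
rewrite -(card_imset _ h_inj); apply: eq_card => f; rewrite inE.
apply/eqP/imsetP => [kerf | [g]].
  have eq_blk x y : (blk x == blk y) = (f x == f y).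
    by rewrite -val_eqE /= eq_pblock ?covP ?inE // -kerf pblock_preim_partition.
  (* The chosen representative of a block is immaterial: by [eq_blk], [f] is constant on blocks. *)
  pose g := [ffun B : D => f (xchoose (blk_surj B))].
  have gE x : g (blk x) = f x.
    by rewrite ffunE; apply/eqP; rewrite -eq_blk (xchooseP (blk_surj (blk x))).
  exists g; last by apply/ffunP => x; rewrite ffunE gE.
  rewrite inE; apply/injectiveP => B1 B2.
  have [x1 /eqP <-] := blk_surj B1; have [x2 /eqP <-] := blk_surj B2.
  by rewrite !gE => /eqP; rewrite -eq_blk => /eqP.
rewrite inE => /injectiveP g_inj ->.
(* [P] is recovered from its relation of lying in a common block, so it suffices to compare
   relations. *)
rewrite -[RHS](equivalence_partition_pblock partP).
apply: eq_in_imset => x _; apply/setP => y; rewrite !inE !ffunE (inj_eq g_inj).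
by rewrite -val_eqE /= eq_pblock ?covP ?inE.
Qed.

(** Maps are sorted by kernel, then kernels by number of blocks. Starting at [r = 0] covers [m = 0]
    too. *)
Lemma expn_sum_ffact_stirling2 (m k : nat) :
  k ^ m = \sum_(0 <= r < k.+1) k ^_ r * stirling2 m r.
Proof.
rewrite big_mkord.
have -> : k ^ m = \sum_(P | partition P [set: 'I_m]) k ^_ #|P|.
  rewrite -{1}[k]card_ord -{1}[m]card_ord -card_ffun -sum1_card.
  pose ker (f : {ffun 'I_m -> 'I_k}) := preim_partition f [set: 'I_m].
  rewrite (partition_big ker (fun P => partition P [set: 'I_m])) /=; last first.
    by move=> f _; apply: preim_partitionP.
  apply: eq_bigr => P partP; rewrite -[in RHS](card_ord k).
  rewrite -(card_preim_partition_fiber _ _ _ partP) -sum1_card.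
  by apply: eq_bigl => f; rewrite inE.
under [RHS]eq_bigr => r _.
  rewrite /stirling2 -sum1_card big_distrr /=.
  under eq_bigl do rewrite inE.
  rewrite big_mkcondr /=.
over.
rewrite exchange_big; apply: eq_bigr => P _ /=.
(* Only [r = #|P|] contributes for a given [P]. If [P] has more than [k] blocks, no [r] in range
   matches, but then [k ^_ #|P|] is 0 as well. *)
rewrite -big_mkcond /=; have [ltPk | leqkP] := ltnP #|P| k.+1.
  by rewrite (big_pred1 (Ordinal ltPk)) /= ?muln1 // => r; rewrite eq_sym.
rewrite ffact_small // big1 // => r /eqP Pr.
by move: leqkP; rewrite Pr ltnNge -ltnS ltn_ord.
Qed.

Lemma stirling2_n0 (m : nat) : 0 < m -> stirling2 m 0 = 0.
Proof.
move=> m_gt0; apply/eqP; rewrite cards_eq0; apply/eqP/setP => P; rewrite !inE.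
apply: contraTF m_gt0 => /andP[partP]; rewrite cards_eq0 => /eqP P0.
have coverP := cover_partition partP; rewrite P0 /cover big_set0 in coverP.
by rewrite -[m]card_ord -cardsT -coverP cards0.
Qed.

Theorem theorem4p3 (X : finType) (Y Z : {set X}) (n m k : nat)
    (hZ0 : Z != set0) (hZY : Z \subset Y)
    (hn : #|X| = n) (hm : #|Y| = m) (hk : #|Z| = k) :
  #|transf Y Z| =
    \sum_(1 <= r < k.+1) 'C(k, r) * r`! * stirling2 m r * n ^ (n - m)
  /\ \sum_(1 <= r < k.+1) 'C(k, r) * r`! * stirling2 m r * n ^ (n - m)
     = k ^ m * n ^ (n - m).
Proof.
have m_gt0 : 0 < m.
  by rewrite -hm; apply: leq_trans (subset_leq_card hZY); rewrite card_gt0.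
have sumE : \sum_(1 <= r < k.+1) 'C(k, r) * r`! * stirling2 m r * n ^ (n - m)
     = k ^ m * n ^ (n - m).
  rewrite -big_distrl /= (expn_sum_ffact_stirling2 m k); congr (_ * _).
  (* The term [r = 0] vanishes because [m > 0], which comes from the nonempty [Z] inside [Y]. *)
  rewrite [RHS]big_ltn // stirling2_n0 // muln0 add0n.
  by apply: eq_bigr => r _; rewrite bin_ffact.
by split=> //; rewrite sumE card_transf hn hm hk.
Qed.
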